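(* Let $a,b,c,d$ be complex numbers, and let $R=R(a,b,c,d)$ be the $9\times9$ matrix $$R=\begin{pmatrix} 0&c&d&c&a^2&ac&d&ac&c^2\\ 0&a&c&a&ab+c&bc+d&c&a^2&ac\\ 1&0&0&0&a&c&0&c&d\\ 0&a&c&a&ab+c&a^2&c&bc+d&ac\\ 1&b&a&b&2a+b^2&ab+c&a&ab+c&a^2\\ 0&1&0&1&b&a&0&a&c\\ 1&0&0&0&a&c&0&c&d\\ 0&1&0&1&b&a&0&a&c\\ 0&0&1&0&1&0&1&0&0 \end{pmatrix},$$ regarded as an endomorphism of $V\otimes V$, where $V$ is a three-dimensional vector space with basis $e_1,e_2,e_3$. Then $R$ satisfies the quantum Yang--Baxter equation $$R_{12}R_{13}R_{23}=R_{23}R_{13}R_{12}$$ in $\mathrm{End}(V\otimes V\otimes V)$ if and only if $$a^2-d-bc=0.$$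
   Context: The matrix is written in the ordered basis $(e_1\otimes e_1,\ e_1\otimes e_2,\ e_1\otimes e_3,\ e_2\otimes e_1,\ e_2\otimes e_2,\ e_2\otimes e_3,\ e_3\otimes e_1,\ e_3\otimes e_2,\ e_3\otimes e_3)$ of $V\otimes V$, with columns being the coordinates of the images of basis vectors. $R_{ij}$ denotes $R$ acting on the $i$-th and $j$-th tensor factors of $V\otimes V\otimes V$ and as the identity on the remaining factor. *)

(* Defs.v *)
From HB Require Import structures.
From mathcomp Require Import all_boot all_order all_algebra.
From mathcomp Require Import reals.
From mathcomp Require Import complex mxtens.

Set Implicit Arguments.
Unset Strict Implicit.
Unset Printing Implicit Defensive.

Import GRing.Theory.
Local Open Scope ring_scope.

(* V = F^n with its standard basis.  V (x) V is F^(n * n), where the vector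
   e_i (x) e_j has (0-based) index [mxtens_index (i, j)], i.e. i * n + j: this
   is the lexicographic order of the basis.  V (x) V (x) V is F^(n * n * n),
   where e_i (x) e_j (x) e_k has index [tens3_index i j k].  A matrix stands
   for the endomorphism v |-> A *m v of column vectors, so its columns are the
   images of the basis vectors and composition is [*m]. *)

Section Legs.
Variables (F : pzRingType) (n : nat).
Implicit Type A : 'M[F]_(n * n).

Definition tens3_index (i j k : 'I_n) : 'I_(n * n * n) :=
  mxtens_index (mxtens_index (i, j), k).

Definition tens3_fst (x : 'I_(n * n * n)) : 'I_n :=
  (mxtens_unindex (mxtens_unindex x).1).1.
Definition tens3_snd (x : 'I_(n * n * n)) : 'I_n :=
  (mxtens_unindex (mxtens_unindex x).1).2.
Definition tens3_trd (x : 'I_(n * n * n)) : 'I_n := (mxtens_unindex x).2.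

Definition leg12 A : 'M[F]_(n * n * n) := A *t 1%:M.

Definition leg13 A : 'M[F]_(n * n * n) :=
  \matrix_(x, y)
    (A (mxtens_index (tens3_fst x, tens3_trd x))
       (mxtens_index (tens3_fst y, tens3_trd y))
     *+ (tens3_snd x == tens3_snd y)).

(* The cast reassociates V (x) (V (x) V) into (V (x) V) (x) V. *)
Definition leg23 A : 'M[F]_(n * n * n) :=
  castmx (mulnA n n n, mulnA n n n) (1%:M *t A).

Definition quantum_yang_baxter A : Prop :=
  leg12 A *m leg13 A *m leg23 A = leg23 A *m leg13 A *m leg12 A.

Lemma tens3_indexP (x : 'I_(n * n * n)) :
  x = tens3_index (tens3_fst x) (tens3_snd x) (tens3_trd x).
Proof.
case: (mxtens_indexP x) => ij k; case: (mxtens_indexP ij) => i j.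
by rewrite /tens3_fst /tens3_snd /tens3_trd !mxtens_indexK.
Qed.

Lemma leg12E A i1 i2 i3 j1 j2 j3 :
  leg12 A (tens3_index i1 i2 i3) (tens3_index j1 j2 j3)
  = A (mxtens_index (i1, i2)) (mxtens_index (j1, j2)) *+ (i3 == j3).
Proof. by rewrite /leg12 tensmxE mxE mulr_natr. Qed.

Lemma leg13E A i1 i2 i3 j1 j2 j3 :
  leg13 A (tens3_index i1 i2 i3) (tens3_index j1 j2 j3)
  = A (mxtens_index (i1, i3)) (mxtens_index (j1, j3)) *+ (i2 == j2).
Proof. by rewrite mxE /tens3_fst /tens3_snd /tens3_trd !mxtens_indexK. Qed.

Lemma leg23E A i1 i2 i3 j1 j2 j3 :
  leg23 A (tens3_index i1 i2 i3) (tens3_index j1 j2 j3)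
  = A (mxtens_index (i2, i3)) (mxtens_index (j2, j3)) *+ (i1 == j1).
Proof.
have tA i j k : cast_ord (esym (mulnA n n n)) (tens3_index i j k)
              = mxtens_index (i, mxtens_index (j, k)).
  by apply: val_inj; rewrite /= mulnDl -mulnA addnA.
by rewrite castmxE !tA tensmxE mxE mulr_natl.
Qed.

(* On a pure tensor B (x) C of endomorphisms, the three operators are
   B (x) C (x) 1, B (x) 1 (x) C and 1 (x) B (x) C. *)
Lemma leg12_tens (B C : 'M[F]_n) : leg12 (B *t C) = B *t C *t 1%:M.
Proof. by []. Qed.

Lemma leg13_tens (B C : 'M[F]_n) : leg13 (B *t C) = B *t 1%:M *t C.
Proof.
apply/matrixP => x y; rewrite [x]tens3_indexP [y]tens3_indexP leg13E !tensmxE.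
by rewrite mxE mulr_natr mulrnAl.
Qed.

Lemma leg23_tens (B C : 'M[F]_n) : leg23 (B *t C) = 1%:M *t B *t C.
Proof.
apply/matrixP => x y; rewrite [x]tens3_indexP [y]tens3_indexP leg23E !tensmxE.
by rewrite mxE mulr_natl mulrnAl.
Qed.

End Legs.

Section RMatrix.
Variable F : pzRingType.
Implicit Types a b c d : F.

Definition Rmx_rows a b c d : seq (seq F) :=
  [:: [:: 0; c; d; c; a ^+ 2;         a * c;     d; a * c;     c ^+ 2];
      [:: 0; a; c; a; a * b + c;      b * c + d; c; a ^+ 2;    a * c ];
      [:: 1; 0; 0; 0; a;              c;         0; c;         d     ];
      [:: 0; a; c; a; a * b + c;      a ^+ 2;    c; b * c + d; a * c ];
      [:: 1; b; a; b; 2 * a + b ^+ 2; a * b + c; a; a * b + c; a ^+ 2];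
      [:: 0; 1; 0; 1; b;              a;         0; a;         c     ];
      [:: 1; 0; 0; 0; a;              c;         0; c;         d     ];
      [:: 0; 1; 0; 1; b;              a;         0; a;         c     ];
      [:: 0; 0; 1; 0; 1;              0;         1; 0;         0     ]].

Definition Rmx a b c d : 'M[F]_(3 * 3) :=
  \matrix_(i, j) nth 0 (nth [::] (Rmx_rows a b c d) i) j.

End RMatrix.

(* Main.v *)
Require Import Defs.
From mathcomp Require Import all_boot all_order all_algebra.
From mathcomp Require Import reals complex.
From mathcomp Require Import mxtens ring.

(* If d = a^2 - bc, then Rmx a b c d is multiplication by
   e_1 (x) e_3 + e_2 (x) e_2 + e_3 (x) e_1 on A (x) A, where
   A = F[x]/(x^3 - b x^2 - 2 a x - c) is commutative with basis e_1 = 1,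
   e_2 = x, e_3 = x^2 - b x - a; so the three operators of the Yang-Baxter
   equation commute with one another.  Conversely, one entry of the difference
   of its two sides is a^2 - d - bc. *)

Import GRing.Theory.
Local Open Scope ring_scope.

Section Legs.
Variables (F : pzRingType) (n : nat).

Lemma leg12_sum (I : finType) (X : I -> 'M[F]_(n * n)) :
  leg12 (\sum_i X i) = \sum_i leg12 (X i).
Proof.
apply/matrixP => x y; rewrite [x]tens3_indexP [y]tens3_indexP leg12E !summxE.
by rewrite -sumrMnl; apply: eq_bigr => i _; rewrite leg12E.
Qed.

Lemma leg13_sum (I : finType) (X : I -> 'M[F]_(n * n)) :
  leg13 (\sum_i X i) = \sum_i leg13 (X i).
Proof.
apply/matrixP => x y; rewrite [x]tens3_indexP [y]tens3_indexP leg13E !summxE.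
by rewrite -sumrMnl; apply: eq_bigr => i _; rewrite leg13E.
Qed.

Lemma leg23_sum (I : finType) (X : I -> 'M[F]_(n * n)) :
  leg23 (\sum_i X i) = \sum_i leg23 (X i).
Proof.
apply/matrixP => x y; rewrite [x]tens3_indexP [y]tens3_indexP leg23E !summxE.
by rewrite -sumrMnl; apply: eq_bigr => i _; rewrite leg23E.
Qed.

Lemma sum_tens3_index (f : 'I_(n * n * n) -> F) :
  \sum_x f x = \sum_i \sum_j \sum_k f (tens3_index i j k).
Proof.
pose g (p : 'I_n * 'I_n * 'I_n) := tens3_index p.1.1 p.1.2 p.2.
pose h x := (tens3_fst x, tens3_snd x, tens3_trd x : 'I_n).
rewrite !pair_bigA /= (reindex g) //; exists h => [p _ | x _].
  case: p => [[i j] k].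
  by rewrite /h /g /tens3_index /tens3_fst /tens3_snd /tens3_trd !mxtens_indexK.
by rewrite /g /h /= -tens3_indexP.
Qed.

(** The leg is the identity on the third factor, so only the two factors it acts on are summed over.
    With its analogues for the other legs, this peels the leftmost operator off a right-associated
    product. *)
Lemma mulmx_leg12E (A : 'M[F]_(n * n)) m (M : 'M[F]_(n * n * n, m)) i j k z :
  (leg12 A *m M) (tens3_index i j k) z =
  \sum_p \sum_q A (mxtens_index (i, j)) (mxtens_index (p, q))
                * M (tens3_index p q k) z.
Proof.
rewrite mxE sum_tens3_index; apply: eq_bigr => p _; apply: eq_bigr => q _.
rewrite (bigD1 k) //= leg12E eqxx mulr1n big1 ?addr0 // => r /negPf rk.
by rewrite leg12E eq_sym rk mulr0n mul0r.
Qed.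

Lemma mulmx_leg13E (A : 'M[F]_(n * n)) m (M : 'M[F]_(n * n * n, m)) i j k z :
  (leg13 A *m M) (tens3_index i j k) z =
  \sum_p \sum_r A (mxtens_index (i, k)) (mxtens_index (p, r))
                * M (tens3_index p j r) z.
Proof.
rewrite mxE sum_tens3_index; apply: eq_bigr => p _; rewrite exchange_big /=.
apply: eq_bigr => r _; rewrite (bigD1 j) //= leg13E eqxx mulr1n.
rewrite big1 ?addr0 // => q /negPf qj.
by rewrite leg13E eq_sym qj mulr0n mul0r.
Qed.

Lemma mulmx_leg23E (A : 'M[F]_(n * n)) m (M : 'M[F]_(n * n * n, m)) i j k z :
  (leg23 A *m M) (tens3_index i j k) z =
  \sum_q \sum_r A (mxtens_index (j, k)) (mxtens_index (q, r))
                * M (tens3_index i q r) z.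
Proof.
rewrite mxE sum_tens3_index (bigD1 i) //= [X in _ + X]big1 => [|p /negPf pi].
  rewrite addr0; apply: eq_bigr => q _; apply: eq_bigr => r _.
  by rewrite leg23E eqxx.
by do 2!(apply: big1 => ? _); rewrite leg23E eq_sym pi mulr0n mul0r.
Qed.

End Legs.

Section Commuting.
Variables (F : comPzRingType) (n : nat).

Lemma comm_tensmx m (A B : 'M[F]_m) (C D : 'M[F]_n) :
  comm_mx A B -> comm_mx C D -> comm_mx (A *t C) (B *t D).
Proof. by rewrite /comm_mx !tensmx_mul => -> ->. Qed.

(** Each leg of a pure tensor has only some [L i] and identities as factors, so the three operators
    commute pairwise and their product can be reversed. *)
Lemma qyb_commuting (I : finType) (L : I -> 'M[F]_n) (f : I -> I) :
  (forall i j, comm_mx (L i) (L j)) ->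
  quantum_yang_baxter (\sum_i L i *t L (f i)).
Proof.
move=> cL; rewrite /quantum_yang_baxter leg12_sum leg13_sum leg23_sum.
set X12 := \sum_i leg12 _; set X13 := \sum_i leg13 _; set X23 := \sum_i leg23 _.
have c1l (A : 'M[F]_n) : comm_mx 1%:M A by exact: comm1mx.
have c1r (A : 'M[F]_n) : comm_mx A 1%:M by exact: comm_mx1.
have c12_13 : comm_mx X12 X13.
  apply: comm_mx_sum => i _; apply/comm_mx_sym/comm_mx_sum => j _.
  by rewrite leg12_tens leg13_tens; apply: comm_tensmx => //; apply: comm_tensmx.
have c12_23 : comm_mx X12 X23.
  apply: comm_mx_sum => i _; apply/comm_mx_sym/comm_mx_sum => j _.
  by rewrite leg12_tens leg23_tens; apply: comm_tensmx => //; apply: comm_tensmx.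
have c13_23 : comm_mx X13 X23.
  apply: comm_mx_sum => i _; apply/comm_mx_sym/comm_mx_sum => j _.
  by rewrite leg13_tens leg23_tens; apply: comm_tensmx => //; apply: comm_tensmx.
by rewrite c12_13 -mulmxA c12_23 mulmxA c13_23.
Qed.

End Commuting.

Section RMatrix.
Variable F : comNzRingType.
Implicit Types a b c d : F.

(* Multiplication by e_2 and by e_3 in the basis (e_1, e_2, e_3) of A. *)
Definition mulx_mx a b c : 'M[F]_3 := \matrix_(i, j)
  nth 0 (nth [::] [:: [:: 0; a; c]; [:: 1; b; a]; [:: 0; 1; 0]] i) j.
Definition mule3_mx a c d : 'M[F]_3 := \matrix_(i, j)
  nth 0 (nth [::] [:: [:: 0; c; d]; [:: 0; a; c]; [:: 1; 0; 0]] i) j.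

Definition basis_mx a b c d (i : 'I_3) : 'M[F]_3 :=
  nth 0 [:: 1%:M; mulx_mx a b c; mule3_mx a c d] i.

(** With X the first matrix, the second is X^2 - b X - a precisely because its corner entry is a^2 -
    bc; a polynomial in X commutes with X. *)
Lemma comm_mulx_mule3 a b c :
  comm_mx (mulx_mx a b c) (mule3_mx a c (a ^+ 2 - b * c)).
Proof.
apply/matrixP => -[[|[|[|//]]] ?] -[[|[|[|//]]] ?];
  rewrite !mxE !big_ord_recl !big_ord0 !mxE /=; ring.
Qed.

Lemma comm_basis_mx a b c i j :
  comm_mx (basis_mx a b c (a ^+ 2 - b * c) i)
          (basis_mx a b c (a ^+ 2 - b * c) j).
Proof.
have c23 := comm_mulx_mule3 a b c.
case: i j => [[|[|[|//]]] ?] [[|[|[|//]]] ?]; rewrite /basis_mx /=;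
  by [exact: comm1mx | exact: comm_mx1 | exact: comm_mx_refl
     | exact: c23 | exact: comm_mx_sym c23].
Qed.

(** [rev_ord] pairs e_1 with e_3 and e_2 with itself. The value of d matters in four entries only,
    where one side has a^2 and the other bc + d. *)
Lemma Rmx_tensE a b c (d := a ^+ 2 - b * c) :
  Rmx a b c d
  = \sum_(i < 3) basis_mx a b c d i *t basis_mx a b c d (rev_ord i).
Proof.
apply/matrixP => x y; case: (mxtens_indexP x) => i j.
case: (mxtens_indexP y) => k l.
rewrite !big_ord_recl big_ord0 !mxE !mxtens_indexK /= {}/d.
case: i j k l =>
  [[|[|[|//]]] ?] [[|[|[|//]]] ?] [[|[|[|//]]] ?] [[|[|[|//]]] ?] /=; ring.
Qed.

Lemma sum_ord3 (f : 'I_3 -> F) (h1 : (1 < 3)%N) (h2 : (2 < 3)%N) :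
  \sum_i f i = f ord0 + f (Ordinal h1) + f (Ordinal h2).
Proof.
rewrite !big_ord_recr big_ord0 /= add0r.
by congr (f _ + f _ + f _); apply: val_inj.
Qed.

Lemma qyb_Rmx_cond a b c d :
  quantum_yang_baxter (Rmx a b c d) -> a ^+ 2 - d - b * c = 0.
Proof.
have sum3 f := sum_ord3 f isT isT.
pose i2 : 'I_3 := Ordinal (isT : 2 < 3)%N.
(* The coefficient of e_1 (x) e_3 (x) e_3 in the image of e_1 (x) e_1 (x) e_3 is a^2 + 2d on the
   left and 3d + bc on the right. *)
move/matrixP/(_ (tens3_index ord0 i2 i2) (tens3_index ord0 ord0 i2)).
rewrite -!mulmxA mulmx_leg12E mulmx_leg23E !sum3 !mulmx_leg13E !sum3.
rewrite !leg12E !leg23E !mxE /=.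
by move/eqP; rewrite -subr_eq0 => /eqP <-; ring.
Qed.

End RMatrix.

Theorem theorem8 (R : realType) (a b c d : R[i]) :
  quantum_yang_baxter (Rmx a b c d) <-> a ^+ 2 - d - b * c = 0.
Proof.
split; first exact: qyb_Rmx_cond.
(* Adding the vanishing a^2 - d - bc to d gives a^2 - bc. *)
move=> abcd0; have -> : d = a ^+ 2 - b * c by rewrite -[LHS]addr0 -abcd0; ring.
by rewrite Rmx_tensE; apply: qyb_commuting; apply: comm_basis_mx.
Qed.
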